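(* If $p(x):=cx^2+ax+b$, where $a,b,c\ge 0$ are real numbers, then $\left\{\frac{p(k)}{k!}\right\}_{k=0}^\infty$ is a multiplier sequence.
   Context: A sequence of real numbers $\{\gamma_k\}_{k=0}^\infty$ is a multiplier sequence if the linear operator $T$ on real polynomials defined by $T[x^k]=\gamma_kx^k$, $k=0,1,2,\ldots$, has the property that $T[p]$ has no non-real zeros whenever the real polynomial $p$ has no non-real zeros (the zero polynomial is regarded as having no non-real zeros). *)

(* Defs.v *)
(* The real numbers are an arbitrary R : realType, the complex numbers R[i]. *)
From mathcomp Require Import all_boot all_order all_algebra.
From mathcomp Require Import reals complex.

Set Implicit Arguments.
Unset Strict Implicit.
Unset Printing Implicit Defensive.

Import Order.TTheory GRing.Theory Num.Theory.
Local Open Scope ring_scope.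

(* The disjunct p = 0 is the convention for the zero polynomial, of which
   every complex number is a root. *)
Definition no_nonreal_zeros (R : realType) (p : {poly R}) : Prop :=
  p = 0 \/
  forall z : R[i], root (map_poly (real_complex R) p) z -> complex.Im z = 0.

Definition diag_op (R : realType) (gamma : nat -> R) (p : {poly R}) : {poly R} :=
  \poly_(k < size p) (gamma k * p`_k).

(* coef_diag_op, diag_op_linear and diag_opXn show that diag_op gamma is the
   linear operator determined by 'X^k |-> gamma k *: 'X^k. *)
Lemma coef_diag_op (R : realType) (gamma : nat -> R) (p : {poly R}) (k : nat) :
  (diag_op gamma p)`_k = gamma k * p`_k.
Proof.
by rewrite coef_poly; case: ltnP => // le_pk; rewrite nth_default ?mulr0.
Qed.

Lemma diag_op_linear (R : realType) (gamma : nat -> R) (u : R) (p q : {poly R}) :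
  diag_op gamma (u *: p + q) = u *: diag_op gamma p + diag_op gamma q.
Proof.
apply/polyP => k.
by rewrite !(coef_diag_op, coefD, coefZ) mulrDr mulrCA.
Qed.

Lemma diag_opXn (R : realType) (gamma : nat -> R) (k : nat) :
  diag_op gamma 'X^k = gamma k *: 'X^k.
Proof.
apply/polyP => j; rewrite coef_diag_op coefZ coefXn.
by case: eqP => [->|]; rewrite ?mulr0.
Qed.

Definition multiplier_sequence (R : realType) (gamma : nat -> R) : Prop :=
  forall p : {poly R},
    no_nonreal_zeros p -> no_nonreal_zeros (diag_op gamma p).

(* Main.v *)
Require Import Defs.
From mathcomp Require Import all_boot all_order all_algebra.
From mathcomp Require Import reals complex.
From mathcomp Require Import ring.
Import Order.TTheory GRing.Theory Num.Theory.
Local Open Scope ring_scope.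
Local Open Scope complex_scope.

Set Implicit Arguments.
Unset Strict Implicit.
Unset Printing Implicit Defensive.

(** Write T for the operator of the sequence gamma_k = p(k) / k!, and let q be
    a nonzero real-rooted polynomial of degree n.  Coefficientwise, T[q] is the
    Schur-Szego composition of q with the Jensen polynomial
    sum_k 'C(n, k) gamma_k x^k, that is, the sum of a_k b_k 'C(n, k) x^k when
    the two polynomials are written with coefficients 'C(n, k) a_k and
    'C(n, k) b_k.  Two facts then give the theorem.

    First, the Jensen polynomial has only real nonpositive zeros
    ([jensen_upper_zero_free], [nonneg_coef_split]).  Up to the factor n!, it is
    J = (c D^2 + a D + b) g, where now D = x d/dx and g(x) = n! L_n(-x) for the
    Laguerre polynomial L_n.  Since g = (1 + d/dx)^n x^n, all the zeros of g
    are real, and they are some -x_i < 0 because the coefficients of g are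
    nonnegative and g(0) <> 0.  Laguerre's differential equation,
    D^2 g = n x g - x D g, eliminates the second derivative:
    J = (c n x + b) g + (a - c x) D g.  Expanding D g / g in partial fractions,
    J / g = b + sum_i (c x_i + a) z / (z + x_i).  Every summand has positive
    imaginary part when Im z > 0, so J does not vanish there (unless all the
    c x_i + a are zero or n = 0, where J = b g; and if J = 0, then T[q] = 0).
    This is where the shape of p enters; p itself may well have non-real zeros.

    Second, the composition of a polynomial without zeros in the upper
    half-plane with prod_i (x + x_i), x_i >= 0, has no zeros in the upper
    half-plane ([szego_upper_zero_free]).  The factors x + x_i are peeled off
    one at a time; at a point z, each of them turns the other polynomial into a
    polar derivative of it, and Laguerre's theorem ([upper_zero_free_polar])
    says that this lowers the degree by one and creates no zero in the upper
    half-plane.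

    All the polynomials that matter at the end are real, so their zeros come in
    conjugate pairs and the upper half-plane is enough. *)

(** * The upper half-plane *)

Definition upper_zero_free {R : rcfType} (q : {poly R[i]}) : Prop :=
  forall z : R[i], 0 < complex.Im z -> q.[z] != 0.

Lemma ImD (R : rcfType) (x y : R[i]) :
  complex.Im (x + y) = complex.Im x + complex.Im y.
Proof. by case: x => ? ?; case: y. Qed.

Lemma ImRM (R : rcfType) (x : R) (y : R[i]) :
  complex.Im (x%:C * y) = x * complex.Im y.
Proof. by case: y => u v /=; rewrite mul0r addr0. Qed.

Lemma Im_sum_gt0 (R : rcfType) (I : eqType) (s : seq I) (F : I -> R[i]) :
  s != [::] -> (forall i, i \in s -> 0 < complex.Im (F i)) ->
  0 < complex.Im (\sum_(i <- s) F i).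
Proof.
elim: s => [//|i s IHs] _ F_gt0; rewrite big_cons ImD.
have Fi_gt0 : 0 < complex.Im (F i) by apply: F_gt0; rewrite inE eqxx.
case: s IHs F_gt0 => [|j s] IHs F_gt0; first by rewrite big_nil /= addr0.
apply: addr_gt0 => //; apply: IHs => // k k_s.
by apply: F_gt0; rewrite inE k_s orbT.
Qed.

Lemma Im_inv_lt0 (R : rcfType) (v : R[i]) :
  0 < complex.Im v -> complex.Im v^-1 < 0.
Proof.
case: v => u v /= v_gt0; rewrite oppr_lt0 divr_gt0 //.
by rewrite ltr_wpDl ?sqr_ge0 ?exprn_gt0.
Qed.

Lemma upperDr_neq0 (R : rcfType) (z : R[i]) (x : R) :
  0 < complex.Im z -> z + x%:C != 0.
Proof.
move=> z_gt0; apply: contraTneq z_gt0 => /(congr1 (@complex.Im R)).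
by rewrite ImD /= addr0 => ->; rewrite ltxx.
Qed.

Lemma Im_divDr_gt0 (R : rcfType) (z : R[i]) (x : R) :
  0 < complex.Im z -> 0 < x -> 0 < complex.Im (z / (z + x%:C)).
Proof.
move=> z_gt0 x_gt0.
have zx_gt0 : 0 < complex.Im (z + x%:C) by rewrite ImD /= addr0.
have zx_neq0 := upperDr_neq0 x z_gt0.
have -> : z / (z + x%:C) = 1 + (- x)%:C * (z + x%:C)^-1.
  by rewrite rmorphN /=; field.
by rewrite ImD ImRM /= add0r mulNr -mulrN mulr_gt0 ?oppr_gt0 ?Im_inv_lt0.
Qed.

(** As w runs over the closed lower half-plane, (z - s w) / (t - w) runs over a
    closed disc deprived of its boundary point s, and misses 0.  The centre of
    the disc is the value at the mirror image of the pole t, a positive multiple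
    of 'i * (s t^* - z); pairing with the direction of the centre therefore gives
    a linear form that is positive on all these values, and such positivity
    survives the summation over several w. *)
Lemma Im_mobius_gt0 (R : rcfType) (s : R) (z t w : R[i]) :
    0 <= s -> 0 < complex.Im z -> 0 < complex.Im t -> complex.Im w <= 0 ->
  0 < complex.Im ((s%:C * t - z^*) * ((z - s%:C * w) / (t - w))).
Proof.
move=> s_ge0; case: z => za zb; case: t => ta tb; case: w => wa wb /=.
move=> zb_gt0 tb_gt0 wb_le0.
have d_gt0 : 0 < (ta - wa) ^+ 2 + (tb - wb) ^+ 2.
  by rewrite ltr_wpDl ?sqr_ge0 ?exprn_gt0 // subr_gt0 (le_lt_trans wb_le0).
set d := _ + _ in d_gt0 *.
set e := (X in 0 < X).
(* This numerator is found by expanding when Re w = 0, a case to which a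
   translation of t and w by Re w and of z by s * Re w reduces. *)
have -> : e = (tb * (za - s * wa) ^+ 2 - wb * (za - s * ta) ^+ 2
   + s * zb * (ta - wa) ^+ 2 + (tb - wb) * (zb + s * tb) * (zb - s * wb)) / d.
  by rewrite /e; ring.
apply: divr_gt0 => //; apply: ltr_wpDl.
  apply: addr_ge0; last by rewrite mulr_ge0 ?sqr_ge0 // mulr_ge0 // ltW.
  apply: addr_ge0; first by rewrite mulr_ge0 ?sqr_ge0 // ltW.
  by rewrite oppr_ge0 mulr_le0_ge0 ?sqr_ge0.
have swb_le0 : s * wb <= 0 by rewrite mulr_ge0_le0.
rewrite !mulr_gt0 ?subr_gt0 //; first exact: le_lt_trans tb_gt0.
  by rewrite ltr_wpDr // mulr_ge0 // ltW.
exact: le_lt_trans zb_gt0.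
Qed.

(** * Logarithmic derivatives and zero-free polynomials *)

Lemma deriv_prod_XsubC_horner (F : fieldType) (s : seq F) (z : F) :
  let q := \prod_(w <- s) ('X - w%:P) in
  q.[z] != 0 -> q^`().[z] = q.[z] * \sum_(w <- s) (z - w)^-1.
Proof.
move=> q; rewrite {}/q; elim: s => [|w s IHs].
  by rewrite !big_nil mulr0 derivC horner0.
rewrite !big_cons derivM derivXsubC mul1r !hornerE mulf_eq0 negb_or.
by case/andP=> zw_neq0 qz_neq0; rewrite IHs //; field.
Qed.

Lemma upper_zero_free_neq0 (R : rcfType) (q : {poly R[i]}) :
  upper_zero_free q -> q != 0.
Proof.
move=> q_free; have := q_free 'i ltr01.
by apply: contraNneq => ->; rewrite horner0.
Qed.

Lemma upper_zero_free_split (R : rcfType) (q : {poly R[i]}) :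
    upper_zero_free q ->
  exists s : seq R[i],
    [/\ q = lead_coef q *: \prod_(w <- s) ('X - w%:P),
        size q = (size s).+1,
        forall w, w \in s -> complex.Im w <= 0
      & forall z, q.[z] != 0 ->
          q^`().[z] = q.[z] * \sum_(w <- s) (z - w)^-1].
Proof.
move=> q_free; have q_neq0 := upper_zero_free_neq0 q_free.
have lq_neq0 : lead_coef q != 0 by rewrite lead_coef_eq0.
have [s /= q_eq] := closed_field_poly_normal q.
exists s; split=> [//|||z qz_neq0].
- by rewrite {1}q_eq size_scale // size_prod_XsubC.
- move=> w w_s; rewrite leNgt; apply: contraL isT => w_gt0.
  have := q_free w w_gt0; rewrite {1}q_eq hornerZ mulf_eq0 negb_or lq_neq0.
  by move: w_s; rewrite -root_prod_XsubC => /rootP ->; rewrite eqxx.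
- move: qz_neq0; rewrite q_eq derivZ !hornerZ mulf_eq0 negb_or => /andP[_ pz].
  by rewrite deriv_prod_XsubC_horner // mulrA.
Qed.

(** At a zero z of q + q' in the upper half-plane, the logarithmic derivative of
    q would be -1, but it is a (possibly empty) sum of inverses of numbers z - w
    with positive imaginary part. *)
Lemma upper_zero_free_addD (R : rcfType) (q : {poly R[i]}) :
  upper_zero_free q -> upper_zero_free (q + q^`()).
Proof.
move=> q_free z z_gt0; have qz_neq0 := q_free z z_gt0.
have [s [_ _ s_le0 q_logderiv]] := upper_zero_free_split q_free.
rewrite hornerD q_logderiv // -{1}[q.[z]]mulr1 -mulrDr mulf_neq0 //.
have [->|s_neq0] := eqVneq s [::]; first by rewrite big_nil addr0 oner_eq0.
have : 0 < complex.Im (\sum_(w <- s) - (z - w)^-1).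
  apply: Im_sum_gt0 => // w /s_le0 w_le0.
  rewrite -mulN1r -(rmorphN1 (real_complex R)) ImRM mulN1r oppr_gt0.
  rewrite Im_inv_lt0 // ImD; case: w w_le0 => a b /= b_le0.
  by rewrite subr_gt0 (le_lt_trans b_le0).
apply: contraTneq => /eqP; rewrite addr_eq0 sumrN => /eqP <-.
by rewrite /= ltxx.
Qed.

Lemma polar_coef (F : idomainType) (g : {poly F}) (N : nat) (s z : F) (k : nat) :
  (s *: (g *+ N - 'X * g^`()) + z *: g^`())`_k
    = s * (g`_k * (N%:R - k%:R)) + z * (g`_k.+1 *+ k.+1).
Proof.
rewrite coefD !coefZ coefB coefMn coefXM !coef_deriv; congr (_ * _ + _).
by case: k => [|k] /=; rewrite mulrBr !mulr_natr.
Qed.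

(** Laguerre's theorem on polar derivatives, with pole z / s (at infinity when
    s = 0).  On the upper half-plane q = g * sum_w (z - s w) / (t - w) over the
    zeros w of g, and this sum is not zero by [Im_mobius_gt0].  The degree is
    exactly one less than that of g because the coefficient in that degree is
    lead_coef g * sum_w (z - s w), where every summand has positive imaginary
    part. *)
Lemma upper_zero_free_polar (R : rcfType) (g : {poly R[i]}) (s : R) (z : R[i]) :
    0 <= s -> 0 < complex.Im z -> (1 < size g)%N -> upper_zero_free g ->
  let q := s%:C *: (g *+ (size g).-1 - 'X * g^`()) + z *: g^`() in
  upper_zero_free q /\ size q = (size g).-1.
Proof.
move=> s_ge0 z_gt0 g_size g_free q.
have [r [g_eq g_sizeE r_le0 g_logderiv]] := upper_zero_free_split g_free.
have r_neq0 : r != [::] by rewrite -size_eq0 -lt0n -ltnS -g_sizeE.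
have lg_neq0 : lead_coef g != 0.
  by rewrite lead_coef_eq0 upper_zero_free_neq0.
split.
  move=> t t_gt0; have gt_neq0 := g_free t t_gt0.
  have -> : q.[t] = g.[t] * \sum_(w <- r) ((z - s%:C * w) / (t - w)).
    transitivity (g.[t] * \sum_(w <- r) (s%:C + (z - s%:C * t) * (t - w)^-1)).
      rewrite big_split /= big_const_seq count_predT -mulr_sumr.
      rewrite iter_addr addr0 /q g_sizeE /= !hornerE g_logderiv // hornerMn.
      by ring.
    congr (_ * _); rewrite !big_seq; apply: eq_bigr => w /r_le0 w_le0.
    have tw_neq0 : t - w != 0.
      by rewrite subr_eq0; apply: contraTneq w_le0 => <-; rewrite -ltNge.
    by field.
  rewrite mulf_neq0 //.
  have : 0 < complex.Im (\sum_(w <- r)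
           (s%:C * t - z^*) * ((z - s%:C * w) / (t - w))).
    by apply: Im_sum_gt0 => // w w_r; apply: Im_mobius_gt0 => //; apply: r_le0.
  by rewrite -mulr_sumr; apply: contraTneq => ->; rewrite mulr0 ltxx.
have g_gt0 : (0 < size g)%N := ltnW g_size.
have gE : g`_(size g) = 0 by rewrite nth_default.
apply/eqP; rewrite eqn_leq; apply/andP; split.
  apply/leq_sizeP => k; rewrite /q polar_coef leq_eqVlt => /predU1P[<-|].
    by rewrite subrr prednK // gE mul0rn !mulr0 addr0.
  rewrite prednK // => le_k.
  by rewrite !nth_default ?mul0r ?mul0rn ?mulr0 ?addr0 // leqW.
have r_size : size r != 0%N by rewrite size_eq0.
rewrite [leqLHS](_ : _ = (size r).-1.+1); last by rewrite g_sizeE prednK ?lt0n.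
rewrite ltnNge; apply/negP => /leq_sizeP/(_ _ (leqnn _)); apply/eqP.
have gE' : g`_(size r).-1 = - lead_coef g * \sum_(w <- r) w.
  by rewrite g_eq coefZ coefPn_prod_XsubC // -g_eq mulrN mulNr.
rewrite /q polar_coef g_sizeE /= prednK ?lt0n // gE'.
have -> : g`_(size r) = lead_coef g by rewrite lead_coefE g_sizeE.
have -> : (size r)%:R - (size r).-1%:R = 1 :> R[i].
  by rewrite -[in X in X - _](prednK (n := size r)) ?lt0n // -natr1; ring.
have -> : s%:C * (- lead_coef g * (\sum_(w <- r) w) * 1)
           + z * (lead_coef g *+ size r)
  = lead_coef g * \sum_(w <- r) (z + (- s)%:C * w).
  rewrite big_split /= big_const_seq count_predT -mulr_sumr iter_addr addr0.
  by rewrite rmorphN /=; ring.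
rewrite mulf_neq0 //.
have : 0 < complex.Im (\sum_(w <- r) (z + (- s)%:C * w)).
  apply: Im_sum_gt0 => // w /r_le0 w_le0.
  by rewrite ImD ImRM ltr_wpDr // mulNr -mulrN mulr_ge0 ?oppr_ge0.
by apply: contraTneq => ->; rewrite ltxx.
Qed.

(** * Schur-Szego composition *)

Definition szego {F : fieldType} (n : nat) (f g : {poly F}) : {poly F} :=
  \poly_(k < n.+1) (f`_k * g`_k / 'C(n, k)%:R).

Lemma szegoZl (F : fieldType) (n : nat) (c : F) (f g : {poly F}) :
  szego n (c *: f) g = c *: szego n f g.
Proof.
apply/polyP => k; rewrite coefZ !coef_poly coefZ.
by case: ltnP; rewrite ?mulr0 // !mulrA.
Qed.

(** For a fixed z, multiplying the first argument by 'X + s amounts to replacing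
    the second one by its polar derivative: this is how the composition theorem
    reduces to Laguerre's theorem. *)
Lemma szego_mul_XaddC (R : rcfType) (n : nat) (f g : {poly R[i]}) (s z : R[i]) :
    (size f <= n.+1)%N ->
  (szego n.+1 (('X + s%:P) * f) g).[z]
    = (szego n f (s *: (g *+ n.+1 - 'X * g^`()) + z *: g^`())).[z] / n.+1%:R.
Proof.
move=> f_size; rewrite !horner_poly mulr_suml.
under eq_bigr => k _ do rewrite mulrDl coefD coefXM coefCM !mulrDl.
rewrite big_split /= big_ord_recl /= !mul0r add0r [X in _ + X]big_ord_recr /=.
rewrite [f`_n.+1]nth_default // mulr0 !mul0r addr0 -big_split /=.
have n1_neq0 : n.+1%:R != 0 :> R[i] by rewrite pnatr_eq0.
apply: eq_bigr => -[k /= k_lt] _; rewrite polar_coef /bump /= add1n add0n.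
have bin_neq0 m j : (j <= m)%N -> 'C(m, j)%:R != 0 :> R[i].
  by move=> le_jm; rewrite pnatr_eq0 -lt0n bin_gt0.
have c0 := bin_neq0 n k k_lt.
have c1 := bin_neq0 n.+1 k (leqW k_lt).
have c2 := bin_neq0 n.+1 k.+1 k_lt.
have e1 : n.+1%:R * 'C(n, k)%:R = (n.+1%:R - k%:R) * 'C(n.+1, k)%:R :> R[i].
  by rewrite -natrB 1?leqW // -!natrM -mul_bin_down.
have e2 : n.+1%:R * 'C(n, k)%:R = k.+1%:R * 'C(n.+1, k.+1)%:R :> R[i].
  by rewrite -!natrM mul_bin_diag.
have -> : 'C(n.+1, k)%:R^-1
  = (n.+1%:R - k%:R) / (n.+1%:R * 'C(n, k)%:R) :> R[i].
  apply: (mulIf c1); rewrite mulVf // mulrAC -e1 divff //.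
  by rewrite mulf_neq0.
have -> : 'C(n.+1, k.+1)%:R^-1 = k.+1%:R / (n.+1%:R * 'C(n, k)%:R) :> R[i].
  apply: (mulIf c2); rewrite mulVf // mulrAC -e2 divff //.
  by rewrite mulf_neq0.
rewrite exprS -[g`_k.+1 *+ _]mulr_natr.
by field; rewrite nat1r n1_neq0 c0.
Qed.

Lemma size_prod_XaddC (F : fieldType) (I : Type) (s : seq I) (c : I -> F) :
  size (\prod_(i <- s) ('X + (c i)%:P)) = (size s).+1.
Proof.
under eq_bigr => i _ do rewrite -[c i]opprK polyCN.
exact: size_prod_XsubC.
Qed.

(** Induction on the number of factors, for a fixed z: each polar derivative has
    the degree and the zero-free region that the next one requires. *)
Lemma szego_upper_zero_free (R : rcfType) (s : seq R) (g : {poly R[i]}) :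
    all (>= 0) s -> size g = (size s).+1 -> upper_zero_free g ->
  upper_zero_free (szego (size s) (\prod_(x <- s) ('X + x%:C%:P)) g).
Proof.
move=> s_ge0 g_size g_free z z_gt0.
elim: s s_ge0 g g_size g_free => [_|x s IHs /= /andP[x_ge0 s_ge0]] g.
  move=> g_size g_free; rewrite big_nil horner_poly big_ord1 /=.
  rewrite expr0 bin0 coef1 eqxx divr1 !mulr1.
  rewrite mul1r; have := upper_zero_free_neq0 g_free.
  by rewrite [g]size1_polyC ?g_size // coefC polyC_eq0.
move=> g_size g_free; rewrite big_cons szego_mul_XaddC ?size_prod_XaddC //.
have [] := @upper_zero_free_polar _ g x z x_ge0 z_gt0 _ g_free.
  by rewrite g_size.
rewrite g_size /= => q_free q_size.
by rewrite mulf_neq0 ?invr_eq0 ?pnatr_eq0 // IHs.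
Qed.

(** * Real polynomials *)

Lemma map_real_root_conj (R : rcfType) (p : {poly R}) (z : R[i]) :
  root (map_poly (real_complex R) p) z^* = root (map_poly (real_complex R) p) z.
Proof.
rewrite -complex_root_conj -map_poly_comp.
by congr (root _ _); apply: eq_map_poly => x; apply: conjc_real.
Qed.

Lemma Im_conj (R : rcfType) (z : R[i]) : complex.Im z^* = - complex.Im z.
Proof. by case: z. Qed.

Lemma upper_zero_free_Im0 (R : rcfType) (p : {poly R}) (z : R[i]) :
    upper_zero_free (map_poly (real_complex R) p) ->
  root (map_poly (real_complex R) p) z -> complex.Im z = 0.
Proof.
move=> p_free pz0; have [z_lt0|z_gt0|//] := ltgtP (complex.Im z) 0.
  have := p_free z^*; rewrite -/(root _ _) map_real_root_conj pz0.
  by rewrite Im_conj oppr_gt0 => /(_ z_lt0).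
by have := p_free z z_gt0; rewrite -/(root _ _) pz0.
Qed.

Lemma horner_gt0 (R : rcfType) (p : {poly R}) (x : R) :
  p != 0 -> (forall k, 0 <= p`_k) -> 0 < x -> 0 < p.[x].
Proof.
move=> p_neq0 p_ge0 x_gt0; rewrite horner_coef.
have -> : size p = (size p).-1.+1 by rewrite prednK // size_poly_gt0.
rewrite big_ord_recr /=; apply: ltr_wpDl.
  by apply: sumr_ge0 => k _; rewrite mulr_ge0 // exprn_ge0 // ltW.
rewrite mulr_gt0 ?exprn_gt0 // lt_def p_ge0 andbT.
by rewrite -lead_coefE lead_coef_eq0.
Qed.

(** The zeros are real by conjugation, and none is positive because a nonzero
    polynomial with nonnegative coefficients is positive on the positive
    axis. *)
Lemma nonneg_coef_split (R : rcfType) (p : {poly R}) :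
    (forall k, 0 <= p`_k) -> upper_zero_free (map_poly (real_complex R) p) ->
  exists s : seq R,
    [/\ all (>= 0) s, size p = (size s).+1
      & map_poly (real_complex R) p
          = (lead_coef p)%:C *: \prod_(x <- s) ('X + x%:C%:P)].
Proof.
move=> p_ge0 p_free; have [r [r_eq r_size _ _]] := upper_zero_free_split p_free.
have p_neq0 : p != 0.
  by have := upper_zero_free_neq0 p_free; rewrite map_poly_eq0.
have r_real w : w \in r -> (complex.Re w)%:C = w /\ complex.Re w <= 0.
  rewrite -root_prod_XsubC => r_w.
  have pw : root (map_poly (real_complex R) p) w.
    by rewrite r_eq rootZ // lead_coef_eq0 map_poly_eq0.
  have w_real := upper_zero_free_Im0 p_free pw.
  case: w pw w_real {r_w} => a b /= pw b0; rewrite b0 in pw *; split=> //.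
  rewrite leNgt; apply/negP => /(horner_gt0 p_neq0 p_ge0).
  move: pw; rewrite [X in root _ X](_ : _ = a%:C) // fmorph_root => /rootP ->.
  by rewrite ltxx.
exists [seq - complex.Re w | w <- r]; split.
- by apply/allP => x /mapP[w /r_real[_ w_le0] ->]; rewrite oppr_ge0.
- by rewrite size_map -r_size size_map_poly.
rewrite r_eq lead_coef_map_eq ?fmorph_eq0 ?lead_coef_eq0 // big_map.
congr (_ *: _); rewrite !big_seq; apply: eq_bigr => w /r_real[w_real _].
by rewrite rmorphN /= w_real polyCN.
Qed.

(** * Laguerre polynomials *)

(** This is n! L_n(-x) for the classical Laguerre polynomial L_n: the operator
    form makes its zeros real at once, by [upper_zero_free_addD]. *)
Definition laguerre (R : nzRingType) (n : nat) : {poly R} :=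
  iter n (fun q : {poly R} => q + q^`()) 'X^n.

Lemma coef_iter_addD (R : rcfType) (m n k : nat) :
  (iter m (fun q : {poly R} => q + q^`()) 'X^n)`_k
    = if (k <= n)%N then 'C(m, n - k)%:R * n`!%:R / k`!%:R else 0.
Proof.
have fact_neq0 j : j`!%:R != 0 :> R by rewrite pnatr_eq0 -lt0n fact_gt0.
elim: m k => [|m IHm] k /=.
  rewrite coefXn; case: ltngtP => [lt_kn|//|->].
    by rewrite bin0n subn_eq0 leqNgt lt_kn !mul0r.
  by rewrite subnn bin0 mul1r divff.
rewrite coefD coef_deriv !IHm; case: (ltngtP k n) => [lt_kn|//|->].
- rewrite -(subnSK lt_kn) binS natrD factS natrM.
  have k1_neq0 : 1 + k%:R != 0 :> R by rewrite nat1r pnatr_eq0.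
  by rewrite -mulr_natr; field; rewrite fact_neq0 k1_neq0.
- by rewrite mul0rn addr0.
- by rewrite subnn !bin0 mul0rn addr0.
Qed.

Lemma coef_laguerre (R : rcfType) (n k : nat) :
  (laguerre R n)`_k = 'C(n, k)%:R * n`!%:R / k`!%:R.
Proof.
rewrite coef_iter_addD; case: leqP => [le_kn|lt_nk]; first by rewrite bin_sub.
by rewrite bin_small // !mul0r.
Qed.

Lemma laguerre_ge0 (R : rcfType) (n k : nat) : 0 <= (laguerre R n)`_k.
Proof. by rewrite coef_laguerre divr_ge0 // mulr_ge0. Qed.

Lemma laguerre_upper_zero_free (R : rcfType) (n : nat) :
  upper_zero_free (map_poly (real_complex R) (laguerre R n)).
Proof.
rewrite /laguerre; move: {1}n => m; elim: m => [|m IHm] /=.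
  move=> z z_gt0; rewrite map_polyXn hornerXn expf_neq0 //.
  by apply: contraTneq z_gt0 => ->; rewrite ltxx.
by rewrite rmorphD /= -deriv_map; apply: upper_zero_free_addD.
Qed.

Lemma size_laguerre (R : rcfType) (n : nat) : size (laguerre R n) = n.+1.
Proof.
apply/eqP; rewrite eqn_leq; apply/andP; split.
  apply/leq_sizeP => k lt_nk.
  by rewrite coef_laguerre bin_small // !mul0r.
rewrite ltnNge; apply/negP => /leq_sizeP/(_ _ (leqnn _)) /eqP.
rewrite coef_laguerre binn mul1r mulf_eq0 invr_eq0 !pnatr_eq0.
by rewrite -!leqn0 leqNgt fact_gt0.
Qed.

(** Strict positivity of the x in s, i.e. the fact that 0 is not a zero, is what
    later gives each (c x + a) z / (z + x) a positive imaginary part: for x = 0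
    this would be the real number a. *)
Lemma laguerre_split (R : rcfType) (n : nat) :
  exists s : seq R,
    [/\ all (> 0) s, size s = n
      & forall z, (forall x, x \in s -> z + x%:C != 0) ->
        let g := map_poly (real_complex R) (laguerre R n) in
        g.[z] != 0 /\ g^`().[z] = g.[z] * \sum_(x <- s) (z + x%:C)^-1].
Proof.
have [s [s_ge0 s_size g_eq]] :=
  nonneg_coef_split (@laguerre_ge0 R n) (@laguerre_upper_zero_free R n).
have g_lead : (lead_coef (laguerre R n))%:C != 0.
  by rewrite fmorph_eq0 lead_coef_eq0 -size_poly_gt0 size_laguerre.
exists s; split.
- have g0_neq0 : (map_poly (real_complex R) (laguerre R n)).[0] != 0.
    rewrite horner_coef0 coef_map fmorph_eq0 coef_laguerre bin0 mul1r fact0.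
    by rewrite divr1 pnatr_eq0 -lt0n fact_gt0.
  apply/allP => x x_s; rewrite lt_def (allP s_ge0) // andbT.
  apply: contraNneq g0_neq0 => x0; rewrite g_eq hornerZ horner_prod.
  rewrite (big_rem x) //= hornerD hornerX hornerC x0 addr0.
  by rewrite mul0r mulr0.
- by apply: succn_inj; rewrite -s_size size_laguerre.
move=> z z_s g; have g_eq' : g = (lead_coef (laguerre R n))%:C *:
    \prod_(w <- [seq - x%:C | x <- s]) ('X - w%:P).
  rewrite /g g_eq big_map; congr (_ *: _); apply: eq_bigr => x _.
  by rewrite polyCN opprK.
have gz_neq0 : (\prod_(w <- [seq - x%:C | x <- s]) ('X - w%:P)).[z] != 0.
  rewrite -/(root _ _) root_prod_XsubC; apply/mapP => -[x x_s z_eq].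
  by have := z_s x x_s; rewrite z_eq addNr eqxx.
rewrite g_eq' derivZ !hornerZ mulf_neq0 // deriv_prod_XsubC_horner //.
split=> //; rewrite mulrA; congr (_ * _); rewrite big_map.
by apply: eq_bigr => x _; rewrite opprK.
Qed.

(** * The Jensen polynomials *)

(** n! times the degree n Jensen polynomial, sum_k 'C(n, k) gamma_k x^k, of the
    sequence gamma_k = (c k^2 + a k + b) / k!. *)
Definition jensen (R : rcfType) (a b c : R) (n : nat) : {poly R} :=
  \poly_(k < n.+1) ((c * k%:R ^+ 2 + a * k%:R + b) * (laguerre R n)`_k).

Lemma coef_jensen (R : rcfType) (a b c : R) (n k : nat) :
  (jensen a b c n)`_k
    = (c * k%:R ^+ 2 + a * k%:R + b) * (laguerre R n)`_k.
Proof.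
rewrite coef_poly; case: ltnP => // lt_nk.
by rewrite [_`_k]nth_default ?mulr0 // size_laguerre.
Qed.

(** The values c k^2 + a k + b are nonnegative and nondecreasing in k, so the one
    at k = n can vanish only if all of them do. *)
Lemma size_jensen (R : rcfType) (a b c : R) (n : nat) :
    0 <= a -> 0 <= b -> 0 <= c -> jensen a b c n != 0 ->
  size (jensen a b c n) = n.+1.
Proof.
move=> a_ge0 b_ge0 c_ge0 J_neq0; apply/eqP.
rewrite eqn_leq size_poly ltnNge; apply: contra J_neq0 => /leq_sizeP Jn0.
apply/eqP/polyP => k; rewrite coef0; have [le_nk|/ltnW le_kn] := leqP n k.
  exact: Jn0.
have /eqP := Jn0 n (leqnn n); rewrite coef_jensen coef_laguerre binn mul1r.
have nfact_neq0 : n`!%:R != 0 :> R by rewrite pnatr_eq0 -lt0n fact_gt0.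
rewrite divff // mulr1 => /eqP pn0.
rewrite coef_jensen.
suff /eqP -> : c * k%:R ^+ 2 + a * k%:R + b == 0 by rewrite mul0r.
rewrite eq_le -{1}pn0 !addr_ge0 ?mulr_ge0 ?exprn_ge0 // andbT.
by rewrite lerD2r lerD ?ler_wpM2l ?lerXn2r ?ler_nat ?nnegrE.
Qed.

(** Laguerre's differential equation in disguise: coefficientwise it is the
    recurrence (k + 1)^2 g_(k+1) = (n - k) g_k, which trades the term c k^2 for
    terms with at most one derivative of g. *)
Lemma jensen_laguerre (R : rcfType) (a b c : R) (n : nat) :
  let g := laguerre R n in
  jensen a b c n
    = (c *+ n) *: ('X * g) + b *: g + 'X * (a *: g^`() - c *: ('X * g^`())).
Proof.
move=> g; apply/polyP => k; rewrite coef_jensen -/g.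
rewrite !coefD !coefZ !coefXM coefB !coefZ coefXM !coef_deriv.
case: k => [|k] /=; first by rewrite expr0n /= !mulr0 !add0r addr0.
have g_rec : k.+1%:R ^+ 2 * g`_k.+1 = (n%:R - k%:R) * g`_k.
  rewrite !coef_laguerre factS natrM.
  have bin_rec : k.+1%:R * 'C(n, k.+1)%:R = (n%:R - k%:R) * 'C(n, k)%:R :> R.
    have [le_kn|lt_nk] := leqP k n.
      by rewrite -natrB // -!natrM mul_bin_left.
    by rewrite !bin_small ?mulr0 // leqW.
  rewrite [in RHS]mulrA [in RHS]mulrA -bin_rec.
  have f_neq0 : k`!%:R != 0 :> R by rewrite pnatr_eq0 -lt0n fact_gt0.
  have k_neq0 : 1 + k%:R != 0 :> R by rewrite nat1r pnatr_eq0.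
  by field; rewrite f_neq0 k_neq0.
by rewrite mulrDl mulrDl -mulrA g_rec; case: k {g_rec} => [|k] /=; ring.
Qed.

(** The quotient of the Jensen polynomial by laguerre R n is
    b + sum_x (c x + a) z / (z + x), with x > 0, and z / (z + x) maps the upper
    half-plane to itself. *)
Lemma jensen_upper_zero_free (R : rcfType) (a b c : R) (n : nat) :
    0 <= a -> 0 <= b -> 0 <= c -> jensen a b c n != 0 ->
  upper_zero_free (map_poly (real_complex R) (jensen a b c n)).
Proof.
move=> a_ge0 b_ge0 c_ge0 J_neq0 z z_gt0.
have [s [/allP s_gt0 s_size g_split]] := laguerre_split R n.
have [] := g_split z (fun x _ => upperDr_neq0 x z_gt0).
set g := map_poly (real_complex R) (laguerre R n) => gz_neq0 g_logderiv.
have -> : (map_poly (real_complex R) (jensen a b c n)).[z] =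
    g.[z] * (b%:C + \sum_(x <- s) (c * x + a)%:C * (z / (z + x%:C))).
  rewrite jensen_laguerre !(rmorphD, rmorphN, rmorphM) /= !map_polyZ /=.
  rewrite !rmorphM /= map_polyX -deriv_map -/g !hornerE g_logderiv.
  transitivity (g.[z] * (b%:C + \sum_(x <- s)
     (c%:C * z + (a%:C * z - c%:C * z * z) * (z + x%:C)^-1))).
    rewrite big_split /= big_const_seq count_predT -mulr_sumr iter_addr addr0.
    by rewrite s_size rmorphMn /=; ring.
  congr (_ * (_ + _)); rewrite !big_seq; apply: eq_bigr => x x_s.
  have zx_neq0 := upperDr_neq0 x z_gt0.
  by rewrite rmorphD rmorphM /=; field.
rewrite mulf_neq0 //.
(* In these two cases the sum is empty or zero, and only b remains. *)
have J_p : (n == 0)%N || (c + a == 0) -> b != 0.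
  apply: contraTneq => b0; apply: contra J_neq0 => n_ca.
  apply/eqP/polyP => k; rewrite coef_jensen b0 addr0 coef0.
  case/orP: n_ca => [/eqP n0|]; last first.
    by rewrite paddr_eq0 // => /andP[/eqP-> /eqP->]; rewrite !mul0r addr0 mul0r.
  case: k => [|k]; first by rewrite expr0n /= !mulr0 addr0 mul0r.
  by rewrite coef_laguerre n0 bin0n !mul0r mulr0.
have [n_ca|] := boolP ((n == 0)%N || (c + a == 0)).
  rewrite big_seq big1 ?addr0 ?fmorph_eq0 ?J_p // => x x_s.
  case/orP: n_ca => [/eqP n0|].
    by move: s_size x_s; rewrite n0; case: (s).
  by rewrite paddr_eq0 // => /andP[/eqP-> /eqP->]; rewrite mul0r addr0 mul0r.
rewrite negb_or => /andP[n_neq0 ca_neq0].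
have : 0 < complex.Im (b%:C + \sum_(x <- s) (c * x + a)%:C * (z / (z + x%:C))).
  rewrite ImD /= add0r; apply: Im_sum_gt0 => [|x /s_gt0 x_gt0].
    by rewrite -size_eq0 s_size.
  have cx_ge0 : 0 <= c * x by rewrite mulr_ge0 // ltW.
  rewrite ImRM mulr_gt0 ?Im_divDr_gt0 // lt_def addr_ge0 // andbT.
  by rewrite paddr_eq0 // mulf_eq0 (gt_eqF x_gt0) orbF -paddr_eq0.
by apply: contraTneq => ->; rewrite ltxx.
Qed.

(** * Multiplier sequences *)

Lemma szego_jensen (R : rcfType) (a b c : R) (n : nat) (p : {poly R}) :
    size p = n.+1 ->
  szego n (map_poly (real_complex R) (jensen a b c n))
      (map_poly (real_complex R) p)
    = (n`!%:R)%:C *: map_poly (real_complex R)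
        (\poly_(k < n.+1) ((c * k%:R ^+ 2 + a * k%:R + b) / k`!%:R * p`_k)).
Proof.
move=> p_size; apply/polyP => k; rewrite coefZ coef_poly !coef_map coef_poly /=.
case: ltnP => // [le_kn|_]; last by rewrite mulr0.
rewrite coef_jensen coef_laguerre.
have bin_neq0 : 'C(n, k)%:R != 0 :> R by rewrite pnatr_eq0 -lt0n bin_gt0.
have f_neq0 : k`!%:R != 0 :> R by rewrite pnatr_eq0 -lt0n fact_gt0.
rewrite -(rmorph_nat (real_complex R)) -fmorphV -!rmorphM; congr (_%:C).
by field; rewrite f_neq0 bin_neq0.
Qed.

Lemma no_nonreal_zeros_upper_zero_free (R : realType) (p : {poly R}) :
  p != 0 -> no_nonreal_zeros p ->
  upper_zero_free (map_poly (real_complex R) p).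
Proof.
move=> p_neq0 [p0|p_real] z z_gt0; first by rewrite p0 eqxx in p_neq0.
by apply: contraTneq z_gt0 => /rootP /p_real ->; rewrite ltxx.
Qed.

Unset Implicit Arguments.

Theorem proposition35 (R : realType) (a b c : R)
    (ha : 0 <= a) (hb : 0 <= b) (hc : 0 <= c) :
  let p : {poly R} := c *: 'X^2 + a *: 'X + b%:P in
  multiplier_sequence (fun k : nat => p.[k%:R] / (k`!)%:R).
Proof.
move=> p q q_real.
have pE k : p.[k%:R] = c * k%:R ^+ 2 + a * k%:R + b by rewrite !hornerE.
have [->|q_neq0] := eqVneq q 0.
  by left; apply/polyP => k; rewrite coef_diag_op !coef0 mulr0.
have q_size : size q = (size q).-1.+1 by rewrite prednK // size_poly_gt0.
set n := (size q).-1 in q_size.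
set T := diag_op _ q.
have T_eq : T = \poly_(k < n.+1)
    ((c * k%:R ^+ 2 + a * k%:R + b) / k`!%:R * q`_k).
  by rewrite /T /diag_op q_size; apply/polyP=> k; rewrite !coef_poly pE.
have := szego_jensen a b c q_size; rewrite -T_eq => szegoE.
have fact_neq0 : (n`!%:R)%:C != 0 :> R[i].
  by rewrite fmorph_eq0 pnatr_eq0 -lt0n fact_gt0.
(* J = 0 happens when p = 0, and for constant q when b = 0. *)
have [J0|J_neq0] := eqVneq (jensen a b c n) 0.
  left; apply/eqP; move/eqP: szegoE; rewrite J0 rmorph0.
  rewrite -[0](scale0r 0) szegoZl scale0r eq_sym scaler_eq0 (negPf fact_neq0).
  by rewrite map_poly_eq0.
right=> z; apply: upper_zero_free_Im0 => w w_gt0.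
have J_ge0 k : 0 <= (jensen a b c n)`_k.
  rewrite coef_jensen mulr_ge0 ?laguerre_ge0 //.
  by rewrite !addr_ge0 ?mulr_ge0 ?exprn_ge0.
have J_size := size_jensen ha hb hc J_neq0.
have [s [s_ge0 s_size J_eq]] :=
  nonneg_coef_split J_ge0 (jensen_upper_zero_free ha hb hc J_neq0).
have sE : size s = n by apply: succn_inj; rewrite -s_size.
have := @szego_upper_zero_free _ s (map_poly (real_complex R) q) s_ge0.
have q_free := no_nonreal_zeros_upper_zero_free q_neq0 q_real.
rewrite size_map_poly sE => /(_ q_size q_free w w_gt0).
move: szegoE; rewrite J_eq szegoZl => /(congr1 (horner^~ w)) /=.
rewrite !hornerZ => E; apply: contraNneq => Tw0.
move/eqP: E; rewrite Tw0 mulr0 mulf_eq0 fmorph_eq0 lead_coef_eq0.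
by rewrite (negPf J_neq0).
Qed.
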